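(* Let $\{X_\alpha,f_{\alpha\beta},D\}$ be an inverse limit system for which each factor space $X_\alpha$ is a Hausdorff continuum, each bonding function $f_{\alpha\beta}:X_\beta\to 2^{X_\alpha}$ is upper semi-continuous and surjective, and $D$ is a totally ordered set. Then $\varprojlim\mathbf{f}$ is a Hausdorff continuum if and only if for each finite subset $\{\beta_1,\beta_2,\ldots,\beta_n\}$ of $D$, $G(\beta_1,\beta_2,\ldots,\beta_n)$ is connected.
   Context: A Hausdorff continuum is a non-empty, compact and connected subset of a Hausdorff space. For a non-empty compact Hausdorff space $X$, $2^X$ denotes the set of non-empty compact subsets of $X$. For non-empty compact Hausdorff spaces $X,Y$, a function $f:X\to 2^Y$ is upper semi-continuous (u.s.c.) if for all $x\in X$ and every open $V\subseteq Y$ containing $f(x)$ there is an open $U\subseteq X$ containing $x$ with $f(u)\subseteq V$ for each $u\in U$ (equivalently, its graph $\{(x,y)\in X\times Y \mid y\in f(x)\}$ is closed). $f$ is surjective if for every $y\in Y$ the set $f^{-1}(y)=\{x\in X\mid y\in f(x)\}$ is non-empty. For u.s.c. $f:X\to 2^Y$ and $g:Y\to 2^Z$, $(g\circ f)(x)=\{z\in Z\mid \exists y\in Y \text{ with } y\in f(x) \text{ and } z\in g(y)\}$. A totally ordered index set is a set $D$ with a reflexive, transitive, antisymmetric and total relation $\preceq$. An inverse limit system $\{X_\alpha,f_{\alpha\beta},D\}$ consists of compact Hausdorff spaces $X_\alpha$ and u.s.c. functions $f_{\alpha\beta}:X_\beta\to 2^{X_\alpha}$ for $\alpha\preceq\beta$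 in $D$, where $f_{\alpha\alpha}$ is the identity on $X_\alpha$ (i.e. $f_{\alpha\alpha}(x)=\{x\}$), such that the collection $\mathbf{f}=\{f_{\alpha\beta}\mid\alpha\preceq\beta\in D\}$ is exact: $f_{\alpha\beta}\circ f_{\beta\eta}=f_{\alpha\eta}$ for all $\alpha\preceq\beta\preceq\eta$ in $D$. The inverse limit is $\varprojlim\mathbf{f}=\{\mathbf{x}\in\prod_{\alpha\in D}X_\alpha\mid x_\alpha\in f_{\alpha\beta}(x_\beta)\ \forall\,\alpha\preceq\beta\in D\}$, with the subspace topology from the product topology. Whenever a finite subset $\{\beta_1,\ldots,\beta_n\}$ of $D$ is written, it is understood that $\beta_i\preceq\beta_j$ iff $i\le j$. For such a subset, $G(\beta_1,\ldots,\beta_n)=\{(x_{\beta_1},\ldots,x_{\beta_n})\in\prod_{1\le i\le n}X_{\beta_i}\mid x_{\beta_i}\in f_{\beta_i\beta_j}(x_{\beta_j})\text{ for }1\le i\le j\le n\}$. *)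

(* Defs.v *)
From mathcomp Require Import all_boot all_order.
From mathcomp Require Import all_classical topology.

Set Implicit Arguments.
Unset Strict Implicit.
Unset Printing Implicit Defensive.

Local Open Scope classical_set_scope.

Definition hausdorff_continuum (T : topologicalType) (A : set T) : Prop :=
  [/\ hausdorff_space T, A !=set0, compact A & connected A].

(* The set 2^Y. *)
Definition hyperspace (Y : topologicalType) : set (set Y) :=
  [set A | A !=set0 /\ compact A].

Arguments hyperspace : clear implicits.

(* Set-valued functions from S to T are rendered as f : S -> set T, so that
   f x y reads "y belongs to f(x)"; values in 2^T are required separately. *)

Definition upper_semicontinuous (S T : topologicalType) (f : S -> set T) : Prop :=
  forall (x : S) (V : set T), open V -> f x `<=` V ->
    exists U : set S, [/\ open U, U x & forall u, U u -> f u `<=` V].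

Definition sv_preimage (S T : Type) (f : S -> set T) (y : T) : set S :=
  [set x | f x y].

Definition sv_surjective (S T : Type) (f : S -> set T) : Prop :=
  forall y, sv_preimage f y !=set0.

Definition sv_comp (S T W : Type) (g : T -> set W) (f : S -> set T) :
    S -> set W :=
  fun x => [set z | exists y, f x y /\ g y z].

(* [f a b] is the bonding function from X_b to 2^(X_a); it is given for all
   pairs of indices, but only constrained or used when a <= b. *)
Definition inverse_limit_system (d : Order.disp_t) (D : orderType d)
    (X : D -> topologicalType) (f : forall a b : D, X b -> set (X a)) : Prop :=
  [/\ forall a, hausdorff_space (X a) /\ compact [set: X a],
      forall a b, (a <= b)%O ->
        (forall x, hyperspace (X a) (f a b x)) /\ upper_semicontinuous (f a b),
      forall a x, f a a x = [set x] &
      forall a b c, (a <= b)%O -> (b <= c)%O ->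
        sv_comp (f a b) (f b c) = f a c].

Definition inverse_limit (d : Order.disp_t) (D : orderType d)
    (X : D -> topologicalType) (f : forall a b : D, X b -> set (X a)) :
    set (prod_topology X) :=
  [set x | forall a b, (a <= b)%O -> f a b (x b) (x a)].

(* Finite subsets {b_1, ..., b_n} of D listed so that b_i <= b_j iff i <= j. *)
Definition increasing_enum (d : Order.disp_t) (D : orderType d) (n : nat)
    (b : 'I_n -> D) : Prop :=
  forall i j : 'I_n, (b i <= b j)%O = (i <= j)%N.

(* The set G(b_1, ..., b_n). *)
Definition finite_graph (d : Order.disp_t) (D : orderType d)
    (X : D -> topologicalType) (f : forall a b : D, X b -> set (X a))
    (n : nat) (b : 'I_n -> D) : set (prod_topology (fun i => X (b i))) :=
  [set x | forall i j : 'I_n, (i <= j)%N -> f (b i) (b j) (x j) (x i)].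

Arguments inverse_limit {d D X} f _.
Arguments finite_graph {d D X} f {n} b _.

(* Main.v *)
(** Every point of a finite graph extends to a point of the inverse limit:
    exactness, surjectivity and non-empty values insert one coordinate at a
    time, and compactness of the product passes to the limit.  So a finite graph
    is the continuous image of the inverse limit.  Conversely, two disjoint
    compact sets separating the inverse limit already have disjoint images in
    some finite product, where they separate a finite graph. *)

Require Import Defs.
From mathcomp Require Import all_boot all_order.
From mathcomp Require Import all_classical topology.

Set Implicit Arguments.
Unset Strict Implicit.
Unset Printing Implicit Defensive.

Import Order.TTheory.

Local Open Scope classical_set_scope.

(** * Compactness along finite lists, closed graphs, finite extrema *)

Lemma compact_seq_meet (T : topologicalType) (I : Type) (K : set T)
    (F : seq I -> set T) :
  compact K -> (forall s, closed (F s)) -> (forall s, K `&` F s !=set0) ->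
  (forall s t, F (s ++ t) `<=` F s `&` F t) ->
  exists2 x, K x & forall s, F s x.
Proof.
move=> cK cF neF Fcat.
(* Concatenation directs the lists, so the intersections of [K] with the [F s] form a filter base; a
   cluster point in [K] lies in every closed [F s]. *)
have PF : ProperFilter (filter_from [set: seq I] (fun s => K `&` F s)).
  apply: filter_from_proper => [|s _]; last exact: neF.
  apply: filter_from_filter; first by exists [::].
  move=> s t _ _; exists (s ++ t) => // x [Kx /Fcat[Fs Ft]].
  by split; split.
have [|x [Kx clx]] := cK _ PF; first by exists [::] => // x [].
exists x => // s; apply: cF => B /clx; rewrite /meets => /(_ (F s)) H.
by apply: H; exists s => // y [].
Qed.

(** Near a point off the graph, regularity of [S2] and upper semicontinuity keep [q] apart from the
    values of [h]. With two coordinate projections as [p] and [q], each bonding condition becomes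
    closed in the product. *)
Lemma closed_pairwise_graph (T S1 S2 : topologicalType) (h : S1 -> set S2)
    (p : T -> S1) (q : T -> S2) :
  hausdorff_space S2 -> compact [set: S2] -> (forall x, compact (h x)) ->
  upper_semicontinuous h -> continuous p -> continuous q ->
  closed [set z | h (p z) (q z)].
Proof.
move=> hS cS ch uh cp cq; rewrite -openC openE => z /= nz.
have clh : closed (h (p z)) by apply: compact_closed.
have nb : nbhs (q z) (~` h (p z)).
  by apply: open_nbhs_nbhs; split => //; rewrite openC.
have [W nW clW] := compact_regular hS cS filterT nb.
have oV : open (~` closure W) by rewrite openC; exact: closed_closure.
have [] := uh (p z) _ oV; first by move=> y hy /clW.
move=> U [oU Uz hU].
have nU : nbhs z (p @^-1` U) by apply: cp; apply: open_nbhs_nbhs.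
have nW' : nbhs z (q @^-1` W) by exact: cq.
near=> y => /= hy.
have /hU /(_ _ hy) : U (p y) by near: y.
by apply; apply: subset_closure; near: y.
Unshelve. all: by end_near. Qed.

(** The relation is left arbitrary so that the order and its converse give a greatest and a least
    element. *)
Lemma has_upper_elt (T : eqType) (r : rel T) (s : seq T) :
  transitive r -> total r -> s != [::] ->
  exists2 m, m \in s & forall x, x \in s -> r x m.
Proof.
move=> tr tot; elim: s => // a [_ _|b s IH _].
  exists a; rewrite ?mem_head // => x; rewrite inE => /eqP ->.
  by have := tot a a; rewrite orbb.
have [//|m ms mP] := IH.
case/orP: (tot a m) => am.
  exists m; first by rewrite inE ms orbT.
  by move=> x; rewrite inE => /predU1P[->//|]; exact: mP.
have raa : r a a by have := tot a a; rewrite orbb.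
exists a; rewrite ?mem_head // => x; rewrite inE => /predU1P[->//|/mP xm].
exact: tr xm am.
Qed.

(** * Restriction to finitely many coordinates *)

Section Threads.
Context (d : Order.disp_t) (D : orderType d) (X : D -> topologicalType).

Lemma coord_continuous (a : D) : continuous (fun z : prod_topology X => z a).
Proof. exact: (@proj_continuous D X a). Qed.

Definition restriction n (b : 'I_n -> D) (z : prod_topology X) :
  prod_topology (fun i => X (b i)) := fun i => z (b i).

Lemma restriction_inj n (b : 'I_n -> D) x y :
  restriction b x = restriction b y -> forall i, x (b i) = y (b i).
Proof. by move=> xy i; rewrite -[x _]/(restriction b x i) xy. Qed.

Lemma restriction_continuous n (b : 'I_n -> D) : continuous (restriction b).
Proof.
move=> z; apply/cvg_sup; first exact/fmap_filter/nbhs_filter.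
move=> i; move: z.
apply/(@continuousP _ (initial_topology (@^~ i))) => A [B oB <-].
have -> : restriction b @^-1` (@^~ i @^-1` B) =
    (fun z : prod_topology X => z (b i)) @^-1` B by [].
by apply: open_comp => // z _; exact: coord_continuous.
Qed.

Definition eq_on (s : seq D) (z : prod_topology X) : set (prod_topology X) :=
  [set x | forall a, a \in s -> x a = z a].

Lemma exists_restriction n (b : 'I_n -> D) (w : prod_topology (fun i => X (b i)))
    (x0 : prod_topology X) :
  injective b -> exists z, restriction b z = w.
Proof.
move=> injb.
(* The value at [a] is [w i] transported along any proof of [b i = a]. Injectivity leaves at most
   one such [i], uniqueness of equality proofs removes the cast, and [x0] fills the coordinates
   outside the range of [b]. *)
have vP : forall a, exists v : X a,
    forall i (e : b i = a), v = eq_rect _ X (w i) _ e.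
  move=> a; case: (pselect (exists i, b i = a)) => [[i <-]|ni].
    exists (w i) => j e; have ji := injb _ _ e; subst j.
    by rewrite (eq_irrelevance e erefl).
  by exists (x0 a) => i e; case: ni; exists i.
exists (fun a => sval (cid (vP a))).
by apply: functional_extensionality_dep => i; exact: svalP (cid (vP (b i))) i erefl.
Qed.

(** * Separating closed sets in a compact product *)

Hypothesis hX : forall a, hausdorff_space (X a).
Hypothesis cX : forall a, compact [set: X a].

Lemma compact_prodT : compact [set: prod_topology X].
Proof.
have := @tychonoff _ X (fun=> setT) cX; congr compact.
by rewrite eqEsubset; split.
Qed.

Lemma closed_eq_on s z : closed (eq_on s z).
Proof.
have -> : eq_on s z =
    \bigcap_(a in [set` s]) (fun x : prod_topology X => x a) @^-1` [set z a].
  by [].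
apply: closed_bigI => a _; apply: preimage_closed.
  by move=> x _; exact: coord_continuous.
exact/accessible_closed_set1/hausdorff_accessible.
Qed.

Lemma hausdorff_restriction n (b : 'I_n -> D) :
  hausdorff_space (prod_topology (fun i => X (b i))).
Proof. exact: (@hausdorff_product _ (fun i => X (b i))). Qed.

Lemma closed_restriction_image n (b : 'I_n -> D) (A : set (prod_topology X)) :
  closed A -> closed (restriction b @` A).
Proof.
move=> cA; apply: compact_closed; first exact: hausdorff_restriction.
apply: continuous_compact.
  exact/continuous_subspaceT/restriction_continuous.
exact: subclosed_compact cA compact_prodT (@subsetT _ _).
Qed.

(** If every finite list fails, compactness gives a point of [A] each of whose finite restrictions
    is shared by some point of [B]. *)
Lemma finite_separation (A B : set (prod_topology X)) :
  closed A -> closed B -> A `&` B = set0 ->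
  exists s, forall x y, A x -> B y -> ~ eq_on s y x.
Proof.
move=> cA cB AB0; apply: contrapT => /forallNP nsep.
have cpt (C : set (prod_topology X)) : closed C -> compact C.
  by move=> cC; exact: subclosed_compact cC compact_prodT (@subsetT _ _).
pose R (s : seq D) := restriction (tnth (in_tuple s)).
have RP s x y : R s x = R s y <-> eq_on s y x.
  split=> [Rxy a sa|xy].
    have /tnthP[i ->] : a \in in_tuple s by [].
    exact: restriction_inj Rxy i.
  by apply: functional_extensionality_dep => i; apply: xy; exact: mem_tnth.
have [||||x Ax xB] := @compact_seq_meet _ D A (fun s => R s @^-1` (R s @` B)).
- exact: cpt.
- move=> s; apply: preimage_closed.
    by move=> x _; exact: restriction_continuous.
  exact: closed_restriction_image.
- move=> s; have /existsNP[x /existsNP[y]] := nsep s.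
  move=> /not_implyP[Ax /not_implyP[By /contrapT xy]].
  by exists x; split => //; exists y => //; apply/esym/RP.
- move=> s t x [y By /RP yx]; split; exists y => //; apply/RP => a Ha;
    by apply: yx; rewrite mem_cat Ha ?orbT.
(* The matching point of [B] so far depends on [s]; a second use of compactness makes it uniform. *)
have [||||y By yx] := @compact_seq_meet _ D B (fun s => eq_on s x).
- exact: cpt.
- by move=> s; exact: closed_eq_on.
- by move=> s; have [y By /RP yx] := xB s; exists y.
- by move=> s t y yx; split=> a Ha; apply: yx; rewrite mem_cat Ha ?orbT.
have yxE : y = x.
  by apply: functional_extensionality_dep => a; apply: (yx [:: a]); rewrite inE.
by have : (A `&` B) x; [split; rewrite -?yxE // yxE|rewrite AB0].
Qed.

(** * Closed conditions imposed by the bonding functions *)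

Context (f : forall a b : D, X b -> set (X a)).
Arguments f : clear implicits.
Hypothesis Hsys : inverse_limit_system f.
Hypothesis Hsurj : forall a b : D, (a <= b)%O -> sv_surjective (f a b).
Hypothesis neX : forall a, [set: X a] !=set0.

(** Partial threads are full points of the product, constrained only at indices in [s], so that all
    of them lie in one compact space. *)
Definition thread_on (s : seq D) : set (prod_topology X) :=
  [set x | forall a b, a \in s -> b \in s -> (a <= b)%O -> f a b (x b) (x a)].

Lemma closed_bond a b : (a <= b)%O ->
  closed [set z : prod_topology X | f a b (z b) (z a)].
Proof.
move=> ab; have [_ /(_ a b ab)[ch uf] _ _] := Hsys.
apply: closed_pairwise_graph => //; try exact: coord_continuous.
by move=> x; case: (ch x).
Qed.

Lemma closed_thread_on s : closed (thread_on s).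
Proof.
have -> : thread_on s =
    \bigcap_(u in [set u | [/\ u.1 \in s, u.2 \in s & (u.1 <= u.2)%O]])
      [set z : prod_topology X | f u.1 u.2 (z u.2) (z u.1)].
  rewrite eqEsubset; split => [x xs [a b] [/= *]|x xs a b *]; first exact: xs.
  by apply: (xs (a, b)).
by apply: closed_bigI => -[a b] [/= _ _]; exact: closed_bond.
Qed.

Lemma closed_inverse_limit : closed (inverse_limit f).
Proof.
have -> : inverse_limit f =
    \bigcap_(u in [set u | (u.1 <= u.2)%O])
      [set z : prod_topology X | f u.1 u.2 (z u.2) (z u.1)].
  rewrite eqEsubset; split => [x xs [a b] /= *|x xs a b *]; first exact: xs.
  by apply: (xs (a, b)).
by apply: closed_bigI => -[a b] /=; exact: closed_bond.
Qed.

(** * Extending partial threads *)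

Lemma bond_trans a b c (x : X a) (y : X b) (z : X c) :
  (a <= b)%O -> (b <= c)%O -> f a b y x -> f b c z y -> f a c z x.
Proof.
by case: Hsys => _ _ _ ex ab bc fx fy; rewrite -(ex _ _ _ ab bc); exists y.
Qed.

(** Only the greatest index [m] of [s] below [c] and the least index [M] above it matter;
    [bond_trans] yields the rest. If both exist, exactness factors [f m M] through [X c]; with only
    [M], the value [f c M (x M)] is non-empty; with only [m], surjectivity of [f m c] supplies the
    point. *)
Lemma thread_on_insert s (x : prod_topology X) c : thread_on s x ->
  exists y : X c, (forall a, a \in s -> (a <= c)%O -> f a c y (x a)) /\
    (forall a, a \in s -> (c <= a)%O -> f c a (x a) y).
Proof.
move=> xs; have [_ ne _ ex] := Hsys.
pose lo := [seq a <- s | (a <= c)%O]; pose hi := [seq a <- s | (c <= a)%O].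
have below m y : m \in lo -> (forall a, a \in lo -> (a <= m)%O) ->
    f m c y (x m) -> forall a, a \in s -> (a <= c)%O -> f a c y (x a).
  rewrite mem_filter => /andP[mc ms] mP fy a sa ac.
  have am : (a <= m)%O by apply: mP; rewrite mem_filter ac.
  exact: bond_trans am mc (xs _ _ sa ms am) fy.
have above m y : m \in hi -> (forall a, a \in hi -> (m <= a)%O) ->
    f c m (x m) y -> forall a, a \in s -> (c <= a)%O -> f c a (x a) y.
  rewrite mem_filter => /andP[cm ms] mP fy a sa ca.
  have ma : (m <= a)%O by apply: mP; rewrite mem_filter ca.
  exact: bond_trans cm ma fy (xs _ _ ms sa ma).
have nlo : lo = [::] -> forall a, a \in s -> (a <= c)%O -> False.
  move=> lo0 a sa ac; have : a \in lo by rewrite mem_filter ac.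
  by rewrite lo0.
have nhi : hi = [::] -> forall a, a \in s -> (c <= a)%O -> False.
  move=> hi0 a sa ca; have : a \in hi by rewrite mem_filter ca.
  by rewrite hi0.
have getlo := @has_upper_elt D <=%O lo le_trans le_total.
have gethi := @has_upper_elt D >=%O hi ge_trans ge_total.
have [lo0|/getlo[m mlo mP]] := eqVneq lo [::];
  have [hi0|/gethi[M Mhi MP]] := eqVneq hi [::].
- have [y _] := neX c.
  by exists y; split=> a sa ac; [case: (nlo lo0 a)|case: (nhi hi0 a)].
- have cM : (c <= M)%O by move: Mhi; rewrite mem_filter => /andP[].
  have [/(_ (x M))[[y fy] _] _] := ne _ _ cM.
  by exists y; split; [move=> a sa ac; case: (nlo lo0 a)|exact: above fy].
- have mc : (m <= c)%O by move: mlo; rewrite mem_filter => /andP[].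
  have [y fy] := Hsurj mc (x m).
  by exists y; split; [exact: below fy|move=> a sa ca; case: (nhi hi0 a)].
- have [mc ms] : (m <= c)%O /\ m \in s.
    by move: mlo; rewrite mem_filter => /andP[].
  have [cM Ms] : (c <= M)%O /\ M \in s.
    by move: Mhi; rewrite mem_filter => /andP[].
  have : f m M (x M) (x m) by apply: xs => //; exact: le_trans cM.
  rewrite -(ex _ _ _ mc cM) => -[y [fy1 fy2]].
  by exists y; split; [exact: below fy2|exact: above fy1].
Qed.

Lemma thread_on_cons s x c : thread_on s x ->
  exists2 z, thread_on (c :: s) z & eq_on s x z.
Proof.
move=> xs; have [cs|ncs] := boolP (c \in s).
  exists x => // a b; rewrite !inE => /predU1P[->|sa] /predU1P[->|sb];
    exact: xs.
have [y [below above]] := thread_on_insert c xs.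
have [_ _ idf _] := Hsys.
have zE a : a \in s -> dfwith x c y a = x a.
  by move=> sa; rewrite dfwithout //; apply: contraNneq ncs => ->.
exists (dfwith x c y); last exact: zE.
move=> a b; rewrite !inE => /predU1P[->|sa] /predU1P[->|sb] ab.
- by rewrite idf.
- by rewrite dfwithin zE //; exact: above.
- by rewrite dfwithin zE //; exact: below.
- by rewrite !zE //; exact: xs.
Qed.

Lemma thread_on_cat t s x : thread_on s x ->
  exists2 z, thread_on (t ++ s) z & eq_on s x z.
Proof.
move=> xs; elim: t => [|c t [z zt zx]]; first by exists x.
have [w wt wz] := thread_on_cons c zt; exists w => // a sa.
by rewrite wz ?mem_cat ?sa ?orbT // zx.
Qed.

(** Finitely many indices can be added without changing [x] on [s]; compactness then treats all
    indices at once, and two-element lists recover every bonding condition. *)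
Lemma thread_on_extend s x : thread_on s x ->
  exists2 z, inverse_limit f z & eq_on s x z.
Proof.
move=> xs.
have [||||z _ zP] :=
    @compact_seq_meet _ D setT (fun t => thread_on t `&` eq_on s x).
- exact: compact_prodT.
- by move=> t; apply: closedI; [exact: closed_thread_on|exact: closed_eq_on].
- move=> t; have [z zt zx] := thread_on_cat t xs; exists z; split => //.
  by split=> // a b ta tb; apply: zt; rewrite mem_cat ?ta ?tb.
- by move=> t u z [zt zx]; split; split => // a b Ha Hb; apply: zt;
    rewrite mem_cat ?Ha ?Hb ?orbT.
exists z; last by have [] := zP [::].
by move=> a b ab; have [zt _] := zP [:: a; b]; apply: zt ab;
  rewrite !inE eqxx ?orbT.
Qed.

(** * The inverse limit and its finite graphs *)

Lemma inverse_limit_neq0 : inverse_limit f !=set0.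
Proof.
pose x : prod_topology X := fun a => sval (cid (neX a)).
(* Over the empty list every point is vacuously a thread. *)
have [|z zL _] := @thread_on_extend [::] x; first by move=> a b.
by exists z.
Qed.

Lemma finite_graphE n (b : 'I_n -> D) : increasing_enum b ->
  finite_graph f b = restriction b @` inverse_limit f.
Proof.
move=> bE.
have injb : injective b.
  move=> i j ij; apply/val_inj/anti_leq.
  by rewrite -!bE ij lexx.
rewrite eqEsubset; split=> [w wG|_ [z zL <-] i j ij]; last first.
  by apply: zL; rewrite bE.
have [x0 _] := inverse_limit_neq0.
have [x xw] := exists_restriction w x0 injb.
have [|z zL zx] := @thread_on_extend (codom b) x.
  move=> _ _ /codomP[i ->] /codomP[j ->]; rewrite bE => /wG.
  by rewrite -xw.
exists z => //; rewrite -xw.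
by apply: functional_extensionality_dep => i; apply: zx; exact: codom_f.
Qed.

Lemma finite_graph_connected n (b : 'I_n -> D) : increasing_enum b ->
  connected (inverse_limit f) -> connected (finite_graph f b).
Proof.
move=> bE Lc; rewrite finite_graphE //.
by apply: connected_continuous_connected => //;
  exact/continuous_subspaceT/restriction_continuous.
Qed.

Lemma inverse_limit_connected :
  (forall n (b : 'I_n -> D), increasing_enum b -> connected (finite_graph f b)) ->
  connected (inverse_limit f).
Proof.
move=> Gc B B0 [C oC BC] [C' cC' BC'].
have cL := closed_inverse_limit.
rewrite eqEsubset; split; first by rewrite BC => x [].
move=> x Lx; apply: contrapT => nBx.
(* The open witness [C] makes the complement [A] of [B] in the limit closed; the closed witness [C']
   does the same for [B]. *)
pose A := inverse_limit f `&` ~` C.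
have cA : closed A by apply: closedI => //; rewrite closedC.
have cB : closed B by rewrite BC'; exact: closedI.
have AB0 : A `&` B = set0.
  by rewrite -subset0 => y; rewrite BC => -[[_ nC] [_ Cy]].
have [s0 s0P] := finite_separation cA cB AB0.
(* Agreement on a list ignores order and repetition, so [s0] can be replaced by a strictly
   increasing list, which indexes a finite graph. *)
pose s := sort <=%O (undup s0).
have ssort : sorted <%O s.
  by rewrite sort_lt_sorted undup_uniq.
pose b := tnth (in_tuple s).
have bE : increasing_enum b.
  move=> i j; rewrite /b !(tnth_nth (b i)).
  by rewrite (lt_sorted_leq_nth (b i) ssort) ?inE.
have sep y z : A y -> B z -> restriction b y <> restriction b z.
  move=> Ay Bz yz; apply: (s0P y z Ay Bz) => a as0.
  have /tnthP[i ->] : a \in in_tuple s by rewrite mem_sort mem_undup.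
  exact: restriction_inj yz i.
have BL : B `<=` inverse_limit f by rewrite BC => y [].
have AL : A `<=` inverse_limit f by move=> y [].
have LAB y : inverse_limit f y -> A y \/ B y.
  by move=> Ly; case: (pselect (C y)) => Cy; [right; rewrite BC|left].
(* The images of [A] and [B] are closed, disjoint by [sep], and cover the finite graph, so the image
   of [B] is relatively clopen and hence the whole graph. *)
have BG : restriction b @` B = finite_graph f b.
  apply: Gc => //.
  - by have [y By] := B0; exists (restriction b y); exists y.
  - exists (~` (restriction b @` A)).
      by rewrite openC; exact: closed_restriction_image.
    rewrite finite_graphE // eqEsubset; split=> [_ [y By <-]|_ [[y Ly <-] nA]].
      by split; [exists y => //; exact: BL|case=> z Az /(sep _ _ Az By)].
    by exists y => //; case: (LAB _ Ly) => // Ay; case: nA; exists y.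
  - exists (restriction b @` B); first exact: closed_restriction_image.
    by rewrite setIC; apply/esym/setIidl; rewrite finite_graphE //;
      exact: image_subset.
have [|Ax|//] := LAB x _; first by [].
(* The point [x] is in [A], yet its restriction lies in the image of [B], against [sep]. *)
have : (restriction b @` B) (restriction b x).
  by rewrite BG finite_graphE //; exists x.
by case=> y By /esym; exact: sep.
Qed.

End Threads.

Theorem theorem5p3 (d : Order.disp_t) (D : orderType d)
    (X : D -> topologicalType) (f : forall a b : D, X b -> set (X a))
    (Hsys : inverse_limit_system f)
    (Hcont : forall a : D, hausdorff_continuum [set: X a])
    (Husc : forall a b : D, (a <= b)%O -> upper_semicontinuous (f a b))
    (Hsurj : forall a b : D, (a <= b)%O -> sv_surjective (f a b)) :
  hausdorff_continuum (inverse_limit f) <->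
  (forall (n : nat) (b : 'I_n -> D), increasing_enum b ->
     connected (finite_graph f b)).
Proof.
have hX a : hausdorff_space (X a) by case: (Hcont a).
have neX a : [set: X a] !=set0 by case: (Hcont a).
have cX a : compact [set: X a] by case: (Hcont a).
split=> [[_ _ _ Lc] n b bE|Gc]; first exact: finite_graph_connected.
split.
- exact: (@hausdorff_product D X hX).
- exact: inverse_limit_neq0.
- apply: subclosed_compact (compact_prodT cX) (@subsetT _ _).
  exact: closed_inverse_limit.
- exact: inverse_limit_connected.
Qed.
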